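(* Let $f_1,\dots,f_n:\mathbb{R}^d\to\mathbb{R}$ be such that each $f_i$ is $L_i$-smooth and $f_i^*=\min_xf_i(x)$ exists; let $x_i$ be a stationary point of $f_i$. Let $\alpha_i\in(0,1)$, $T_i(x)=\alpha_ix+(1-\alpha_i)x_i$, $\tilde f(x)=\frac1n\sum_if_i(T_i(x))$, $L_\alpha=\frac1n\sum_i\alpha_i^2L_i$ and $f^*=\frac1n\sum_if_i^*$. Let $\omega_i\ge0$ and consider distributed compressed gradient descent on $\tilde f$: $x^{t+1}=x^t-\gamma\frac1n\sum_{i=1}^n\mathcal{C}_i^t(\alpha_i\nabla f_i(T_i(x^t)))$, with $\mathcal{C}_i^t\in\mathbb{B}^d(\omega_i)$ drawn independently across $i,t$. If $0<\gamma\leq\frac{1}{L_\alpha}$, then for all $k\geq1$ \[\min_{0\leq t\leq k-1}\mathbb{E}\|\nabla\tilde f(x^t)\|^2\leq\frac{2\left(1+\frac{2L_\alpha\gamma^2\max_i\{L_i\omega_i\alpha_i^2\}}{n}\right)^k}{\gamma k}(\tilde f(x^0)-f^* ).\]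
   Context: A (random) operator $\mathcal{C}$ belongs to $\mathbb{B}^d(\omega)$ if $\mathbb{E}[\mathcal{C}(x)] = x$ and $\mathbb{E}\|\mathcal{C}(x)-x\|^2\leq\omega\|x\|^2$ for all $x$. A differentiable $g$ is $L$-smooth if $\|\nabla g(x)-\nabla g(y)\|\leq L\|x-y\|$ for all $x,y$. No convexity is assumed. *)

(* Defs.v *)
From HB Require Import structures.
From mathcomp Require Import all_boot all_order all_algebra.
From mathcomp Require Import all_classical all_reals all_analysis.
Set Implicit Arguments. Unset Strict Implicit. Unset Printing Implicit Defensive.
Import Order.TTheory GRing.Theory Num.Theory.
Import numFieldNormedType.Exports.
Local Open Scope classical_set_scope.
Local Open Scope ring_scope.

Section defs.
Context {R : realType} {d : nat}.

Definition sqnorm (x : 'rV[R]_d) : R := \sum_(j < d) x 0 j ^+ 2.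
Definition enorm (x : 'rV[R]_d) : R := Num.sqrt (sqnorm x).

Definition grad (g : 'rV[R]_d -> R) (x : 'rV[R]_d) : 'rV[R]_d :=
  \row_(j < d) derive g x (delta_mx 0 j).

Definition Lsmooth (g : 'rV[R]_d -> R) (L : R) : Prop :=
  (forall x, differentiable g x) /\
  (forall x y, enorm (grad g x - grad g y) <= L * enorm (x - y)).

(** Borel sigma-algebra on R^d: generated by the coordinate maps *)
Definition coord_sets : set (set 'rV[R]_d) :=
  [set B | exists (j : 'I_d) (A : set R), measurable A /\ B = (fun x : 'rV[R]_d => x 0 j) @^-1` A].
Definition vecM := g_sigma_algebraType coord_sets.

Definition in_B {dO} {O : measurableType dO} (P : probability O R)
  (C : O -> 'rV[R]_d -> 'rV[R]_d) (om : R) : Prop :=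
  forall x : 'rV[R]_d,
    (forall j, P.-integrable setT (fun w => (C w x 0 j)%:E)) /\
    (forall j, (\int[P]_w (C w x 0 j)%:E = (x 0 j)%:E)%E) /\
    (\int[P]_w (sqnorm (C w x - x))%:E <= (om * sqnorm x)%:E)%E.

Definition Tmap (a : R) (xi x : 'rV[R]_d) : 'rV[R]_d := a *: x + (1 - a) *: xi.

Definition ftilde {n} (f : 'I_n -> 'rV[R]_d -> R) (alpha : 'I_n -> R)
  (xs : 'I_n -> 'rV[R]_d) (x : 'rV[R]_d) : R :=
  n%:R^-1 * \sum_(i < n) f i (Tmap (alpha i) (xs i) x).

End defs.

Definition mutually_independent {R : realType} {I : eqType} {dO} {O : measurableType dO}
  (P : probability O R) {dS} {S : measurableType dS} (X : I -> O -> S) : Prop :=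
  (forall i, measurable_fun setT (X i)) /\
  (forall (J : seq I) (A : I -> set S), uniq J -> (forall i, measurable (A i)) ->
     P (\bigcap_(i in [set` J]) (X i @^-1` A i)) = (\prod_(i <- J) P (X i @^-1` A i))%E).

(* Main.v *)
(** Write [g x] for the gradient of the shifted average.  Summing the descent
    lemma over the [f_i \o T_i] gives a quadratic upper bound with constant
    [Lalpha].  For a fixed iterate [x] the compressed gradient is
    [g x + N] with [N] centred; independence across clients makes the cross
    terms vanish, so
    [E|N|^2 <= n^-2 * \sum_i om_i alpha_i^2 |grad f_i (T_i x)|^2], and
    [|grad f_i|^2 <= 2 L_i (f_i - min f_i)] turns this into
    [2 M / n * (ftilde x - fstar)].  Hence one step satisfies
    [E(ftilde x^+ - fstar) + gamma/2 |g x|^2 <= (1 + a) (ftilde x - fstar)].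
    Independence across iterations lets one substitute the random iterate for
    [x]; since [1 + a >= 1], iterating gives
    [E(ftilde x^k - fstar) + gamma/2 * \sum_(t < k) E|g x^t|^2
     <= (1 + a)^k (ftilde x^0 - fstar)], and the minimum is at most the mean. *)
Require Import Defs.
From HB Require Import structures.
From mathcomp Require Import all_boot all_order all_algebra.
From mathcomp Require Import all_classical all_reals all_analysis.
From mathcomp Require Import measurable_realfun ring lra.
Import Order.TTheory GRing.Theory Num.Theory.
Import numFieldNormedType.Exports.
Local Open Scope classical_set_scope.
Local Open Scope ring_scope.

Set Implicit Arguments.
Unset Strict Implicit.
Unset Printing Implicit Defensive.

(** * Independence *)

Definition indep_elts {R : realType} {dO d1 d2} {O : measurableType dO}
    {T1 : measurableType d1} {T2 : measurableType d2}
    (P : probability O R) (U : O -> T1) (V : O -> T2) : Prop :=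
  forall A B, measurable A -> measurable B ->
    P (U @^-1` A `&` V @^-1` B) = (P (U @^-1` A) * P (V @^-1` B))%E.

(** For fixed [D] both sides are finite measures in [A]: the image under [U] of [P] restricted to
    [D], and the law of [U] scaled by [P D]. Agreement on a pi-system containing the whole space
    extends to the generated sigma-algebra. *)
Lemma indep_elts_pi_left {R : realType} {dO d1} {O : measurableType dO}
    {T1 : measurableType d1} (P : probability O R) (U : O -> T1) (D : set O)
    (G1 : set (set T1)) :
  measurable_fun setT U -> measurable D ->
  measurable = <<s G1 >> -> setI_closed G1 -> G1 setT ->
  (forall A, G1 A -> P (U @^-1` A `&` D) = (P (U @^-1` A) * P D)%E) ->
  forall A, measurable A -> P (U @^-1` A `&` D) = (P (U @^-1` A) * P D)%E.
Proof.
move=> mU mD G1E G1I G1T HG.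
pose Um : {mfun O >-> T1} := HB.pack U (isMeasurableFun.Build _ _ _ _ U mU).
pose m1 : {measure set T1 -> \bar R} :=
  measure_function_pushforward__canonical__measure_function_Measure (mrestr P mD) mU.
have PD0 : 0 <= fine (P D) by rewrite fine_ge0.
pose m2 : {measure set T1 -> \bar R} :=
  mscale (NngNum PD0) (distribution P Um).
have m2E A : m2 A = (P (U @^-1` A) * P D)%E.
  rewrite /m2/= /mscale/= fineK ?fin_num_measure// muleC//.
move=> A mA; rewrite -m2E.
apply: (@measure_unique _ R T1 G1 (fun=> setT) G1E G1I _ _ m1 m2) => //.
- by apply/seteqP; split=> // x _; exists 0%N.
- by move=> B GB; rewrite m2E -HG.
- move=> _ /=; rewrite /pushforward /mrestr ltey_eq fin_num_measure// preimage_setT setTI//.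
Qed.

(** The one-sided extension is applied twice: to [V] with a measurable [U]-event fixed, then to [U]
    with a generator event of [V] fixed. *)
Lemma indep_elts_pi {R : realType} {dO d1 d2} {O : measurableType dO}
    {T1 : measurableType d1} {T2 : measurableType d2}
    (P : probability O R) (U : O -> T1) (V : O -> T2)
    (G1 : set (set T1)) (G2 : set (set T2)) :
  measurable_fun setT U -> measurable_fun setT V ->
  measurable = <<s G1 >> -> setI_closed G1 -> G1 setT ->
  measurable = <<s G2 >> -> setI_closed G2 -> G2 setT ->
  (forall A B, G1 A -> G2 B ->
    P (U @^-1` A `&` V @^-1` B) = (P (U @^-1` A) * P (V @^-1` B))%E) ->
  indep_elts P U V.
Proof.
move=> mU mV G1E G1I G1T G2E G2I G2T HG A B mA mB.
have mVB C : measurable C -> measurable (V @^-1` C).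
  by move=> mC; rewrite -[_ @^-1` _]setTI; exact: mV.
have mUA C : measurable C -> measurable (U @^-1` C).
  by move=> mC; rewrite -[_ @^-1` _]setTI; exact: mU.
rewrite setIC muleC.
apply: (indep_elts_pi_left mV (mUA _ mA) G2E G2I G2T) => // C GC.
rewrite setIC muleC.
apply: (indep_elts_pi_left mU _ G1E G1I G1T) => //.
- by apply: mVB; rewrite G2E; exact: sub_sigma_algebra.
- by move=> D GD; exact: HG.
Qed.

(** * Freezing one of two independent random elements *)

Section freezing.
Local Open Scope ereal_scope.
Context {R : realType} {dO d1 d2} {O : measurableType dO}
    {T1 : measurableType d1} {T2 : measurableType d2}
    (P : probability O R) (U : O -> T1) (V : O -> T2).
Hypothesis mU : measurable_fun setT U.
Hypothesis mV : measurable_fun setT V.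
Hypothesis UV : indep_elts P U V.
Let Um : {mfun O >-> T1} := HB.pack U (isMeasurableFun.Build _ _ _ _ U mU).
Let Vm : {mfun O >-> T2} := HB.pack V (isMeasurableFun.Build _ _ _ _ V mV).
Let mUV : measurable_fun setT (fun w => (U w, V w)).
Proof. exact: measurable_fun_pair. Qed.
Let UVm : {mfun O >-> (T1 * T2)%type} :=
  HB.pack (fun w => (U w, V w)) (isMeasurableFun.Build _ _ _ _ _ mUV).

(** Independence is the product formula on rectangles, which characterises the product measure. *)
Let law_prod (A : set (T1 * T2)) : measurable A ->
  (distribution P Um \x distribution P Vm) A = distribution P UVm A.
Proof.
apply: product_measure_unique => A1 A2 mA1 mA2; exact: UV.
Qed.

(** The pair has the product law, so Tonelli splits the integral; in the inner one [U w] is a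
    constant. This is what later replaces a random iterate by a fixed point. *)
Lemma ge0_integral_indep (h : T1 * T2 -> \bar R) :
  measurable_fun [set: T1 * T2] h -> (forall z, 0 <= h z) ->
  \int[P]_w h (U w, V w) = \int[P]_w \int[P]_w' h (U w, V w').
Proof.
move=> mh h0.
transitivity (\int[distribution P UVm]_z h z).
  by rewrite ge0_integral_pushforward.
rewrite (eq_measure_integral (distribution P Um \x distribution P Vm)); last first.
  by move=> A mA _; apply/esym; exact: law_prod.
rewrite fubini_tonelli1// ge0_integral_pushforward//; last 2 first.
- exact: measurable_fun_fubini_tonelli_F.
- by move=> x _; apply: integral_ge0.
apply: eq_integral => w _ /=.
rewrite /fubini_F ge0_integral_pushforward//.
exact: measurableT_comp.
Qed.

End freezing.

Lemma integral_prob_cst {R : realType} {dO} {O : measurableType dO}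
    (P : probability O R) (r : R) : (\int[P]_w r%:E = r%:E)%E.
Proof. by rewrite integral_cst// [X in (_ * X)%E](probability_setT P) mule1. Qed.

(* Tonelli applied to the nonnegative square avoids integrating the cross term,
   so [phi] need not be integrable. *)
Lemma integral_sqr_add_indep {R : realType} {dO d1 d2} {O : measurableType dO}
    {T1 : measurableType d1} {T2 : measurableType d2}
    (P : probability O R) (U : O -> T1) (V : O -> T2)
    (phi : T1 -> R) (psi : T2 -> R) :
  measurable_fun setT U -> measurable_fun setT V -> indep_elts P U V ->
  measurable_fun setT phi -> measurable_fun setT psi ->
  P.-integrable setT (fun w => (psi (V w))%:E) ->
  P.-integrable setT (fun w => (psi (V w) ^+ 2)%:E) ->
  (\int[P]_w (psi (V w))%:E = 0)%E ->
  (\int[P]_w ((phi (U w) + psi (V w)) ^+ 2)%:E =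
   \int[P]_w (phi (U w) ^+ 2)%:E + \int[P]_w (psi (V w) ^+ 2)%:E)%E.
Proof.
move=> mU mV UV mphi mpsi ipsi ipsi2 psi0.
pose h (z : T1 * T2) := ((phi z.1 + psi z.2) ^+ 2)%:E.
have mh : measurable_fun [set: T1 * T2] h.
  apply/measurable_EFinP; apply: measurable_funX; apply: measurable_funD.
  - exact: measurableT_comp.
  - exact: measurableT_comp.
rewrite (@ge0_integral_indep _ _ _ _ _ _ _ P U V mU mV UV h mh); last first.
  by move=> z; rewrite lee_fin sqr_ge0.
(* With [U w] frozen, the cross term is a constant times the centred [psi (V w')], hence integrable
   with mean zero. *)
have inner w : (\int[P]_w' h (U w, V w') =
    (phi (U w) ^+ 2)%:E + \int[P]_w' (psi (V w') ^+ 2)%:E)%E.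
  rewrite /h/=.
  under eq_integral.
    move=> w' _; rewrite sqrrD -mulr_natl mulrA addrAC EFinD EFinD EFinM.
    over.
  have i1 : P.-integrable setT (fun=> (phi (U w) ^+ 2)%:E).
    by apply: finite_measure_integrable_cst.
  have i2 : P.-integrable setT (fun w' => (2 * phi (U w))%:E * (psi (V w'))%:E)%E.
    exact: integrableZl.
  have e2 : (\int[P]_w' ((2 * phi (U w))%:E * (psi (V w'))%:E) = 0)%E.
    by rewrite integralZl// psi0 mule0.
  rewrite integralD//=; last exact: integrableD.
  rewrite integralD// e2 adde0.
  by rewrite integral_prob_cst.
under eq_integral do rewrite inner.
have f2 : (\int[P]_w' (psi (V w') ^+ 2)%:E)%E \is a fin_num.
  exact: integrable_fin_num.
rewrite ge0_integralD//=.
- by rewrite -{1}(fineK f2) integral_prob_cst fineK.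
- by move=> x _; rewrite lee_fin sqr_ge0.
- by apply/measurable_EFinP; apply: measurable_funX; apply: measurableT_comp.
- by move=> x _; apply: integral_ge0 => y _; rewrite lee_fin sqr_ge0.
Qed.

(** * Sigma-algebras generated by sub-families of the samples *)

Section cylinders.
Context {R : realType} {I : choiceType} {dO dS} {O : measurableType dO}
  {S : measurableType dS} (P : probability O R) (xi : I -> O -> S).

(** Finite intersections are taken so as to get a pi-system on which mutual independence evaluates
    [P] directly. *)
Definition cylinders (K : set I) : set (set O) :=
  [set B | exists (J : seq I) (A : I -> set S),
    [/\ uniq J, [set` J] `<=` K, (forall i, measurable (A i)) &
        B = \bigcap_(i in [set` J]) (xi i @^-1` A i)]].

(* [O] with the sigma-algebra generated by the [xi i], [i \in K]; the identity
   [O -> cylType K] is then a random element carrying exactly that information. *)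
Definition cylType (K : set I) := g_sigma_algebraType (cylinders K).

Lemma cylinders_setT (K : set I) : cylinders K setT.
Proof.
by exists [::], (fun=> setT); split => //; rewrite bigcap_set_type; apply/seteqP; split.
Qed.

Lemma cylindersI (K : set I) : setI_closed (cylinders K).
Proof.
move=> _ _ [J1 [A1 [uJ1 J1K mA1 ->]]] [J2 [A2 [uJ2 J2K mA2 ->]]].
(* An index missing from one list imposes no constraint there, hence the default [setT]. *)
exists (undup (J1 ++ J2)),
  (fun i => (if i \in J1 then A1 i else setT) `&` (if i \in J2 then A2 i else setT)).
split.
- exact: undup_uniq.
- move=> i /=; rewrite mem_undup mem_cat => /orP[]; [exact: J1K|exact: J2K].
- by move=> i; apply: measurableI; case: ifPn.
- apply/seteqP; split.
  + move=> w [h1 h2] i /= _; split; case: ifPn => // iJ; [exact: h1|exact: h2].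
  + move=> w h; split => i /= iJ.
      by have := h i; rewrite /= mem_undup mem_cat iJ => /(_ isT)[].
    by have := h i; rewrite /= mem_undup mem_cat iJ orbT => /(_ isT)[].
Qed.

Lemma measurable_cyl (K : set I) i : K i ->
  measurable_fun setT (xi i : cylType K -> S).
Proof.
move=> Ki _ A mA; rewrite setTI; apply: sub_sigma_algebra.
exists [:: i], (fun=> A); split => //.
- by move=> j /=; rewrite inE => /eqP ->.
- by rewrite bigcap_seq big_seq1.
Qed.

(** More samples generate a finer sigma-algebra; this carries measurability of an iterate to the
    next time. *)
Lemma cyl_sub (K K' : set I) : K `<=` K' ->
  measurable_fun setT (id : cylType K' -> cylType K).
Proof.
move=> KK' _ A mA; rewrite setTI preimage_id.
apply: sub_sigma_algebra2 mA => B [J [C [uJ JK mC ->]]].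
by exists J, C; split => // i /JK /KK'.
Qed.

Hypothesis Ixi : mutually_independent P xi.

Lemma cyl_measurable (K : set I) : measurable_fun setT (id : O -> cylType K).
Proof.
move=> _ A mA; rewrite setTI preimage_id.
suff : <<s cylinders K >> `<=` @measurable _ O by apply.
apply: smallest_sub; first exact: sigma_algebra_measurable.
move=> _ [J [C [uJ _ mC ->]]].
rewrite bigcap_seq; apply: big_ind => //; first exact: measurableI.
by move=> i _; rewrite -[_ @^-1` _]setTI; apply: (Ixi.1 i).
Qed.

(** Two cylinders over disjoint index lists meet in a cylinder over the concatenated list, whose
    probability factors; the pi-system criterion does the rest. *)
Lemma indep_cyl (K1 K2 : set I) : K1 `&` K2 = set0 ->
  indep_elts P (id : O -> cylType K1) (id : O -> cylType K2).
Proof.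
move=> K12; apply: (@indep_elts_pi _ _ _ _ _ (cylType K1) (cylType K2) P id id
  (cylinders K1) (cylinders K2)) => //.
- exact: cyl_measurable.
- exact: cyl_measurable.
- exact: cylindersI.
- exact: cylinders_setT.
- exact: cylindersI.
- exact: cylinders_setT.
move=> _ _ [J1 [A1 [uJ1 J1K mA1 ->]]] [J2 [A2 [uJ2 J2K mA2 ->]]].
rewrite !preimage_id.
have J12 i : i \in J1 -> i \in J2 -> False.
  move=> i1 i2; suff : set0 i by [].
  by rewrite -K12; split; [exact: J1K|exact: J2K].
(* One family for the joined list; disjointness makes it agree with [A2] on [J2]. *)
pose A i := if i \in J1 then A1 i else A2 i.
have mA i : measurable (A i) by rewrite /A; case: ifPn.
have u12 : uniq (J1 ++ J2).
  rewrite cat_uniq uJ1 uJ2 andbT/=; apply/hasPn => i i2; apply/negP => i1.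
  exact: J12 i1 i2.
have -> : \bigcap_(i in [set` J1]) xi i @^-1` A1 i `&`
          \bigcap_(i in [set` J2]) xi i @^-1` A2 i =
          \bigcap_(i in [set` J1 ++ J2]) xi i @^-1` A i.
  apply/seteqP; split => w.
    move=> [h1 h2] i /=; rewrite /A mem_cat; case: ifPn => /=.
      by move=> i1 _; exact: h1.
    by move=> _ i2; exact: h2.
  move=> h; split => i /= iJ.
    by have := h i; rewrite /= mem_cat /A iJ => /(_ isT).
  have := h i; rewrite /= mem_cat /A iJ orbT => /(_ isT).
  by case: ifPn => // i1; have := J12 _ i1 iJ.
rewrite !Ixi.2// big_cat/=; congr (_ * _)%E; apply: eq_big_seq => i iJ.
  by rewrite /A iJ.
by rewrite /A; case: ifPn => // i1; have := J12 _ i1 iJ.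
Qed.

End cylinders.

(** * Borel measurability on R^d *)

Section vector_measurability.
Context {R : realType} {d : nat}.

Lemma measurable_coord (j : 'I_d) :
  measurable_fun setT (fun x : @vecM R d => x 0 j).
Proof.
move=> _ A mA; rewrite setTI; apply: sub_sigma_algebra.
by exists j, A.
Qed.

Lemma measurable_vecP {dT} {T : measurableType dT} (X : T -> @vecM R d) :
  (forall j, measurable_fun setT (fun w => X w 0 j)) -> measurable_fun setT X.
Proof.
move=> mX; apply: (@measurability _ _ _ (@vecM R d) setT X coord_sets) => // _ [B [j [A [mA ->]]] <-].
by rewrite setTI -[X in measurable X]setTI; exact: mX.
Qed.

Lemma measurable_box (q : 'rV[rat]_d) (m : nat) :
  measurable [set y : @vecM R d |
    forall j, `|ratr (q 0 j) - y 0 j| < m.+1%:R^-1].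
Proof.
rewrite [X in measurable X](_ : _ = \bigcap_(j in [set: 'I_d])
    ((fun y : @vecM R d => y 0 j) @^-1` ball (ratr (q 0 j) : R) m.+1%:R^-1)); last first.
  by apply/seteqP; split => y h j; [move=> _; exact: h|exact: h].
apply: fin_bigcap_measurable => // j _.
by rewrite -[X in measurable X]setTI; apply: measurable_coord => //; exact: measurable_ball.
Qed.

(** The sigma-algebra of [vecM] is generated by coordinates, so an open set is written as the
    countable union of the rational boxes it contains. *)
Lemma open_measurable_vec (V : set 'rV[R]_d) :
  open V -> measurable (V : set (@vecM R d)).
Proof.
move=> oV.
pose box (qm : 'rV[rat]_d * nat) : set 'rV[R]_d :=
  [set y | forall j, `|ratr (qm.1 0 j) - y 0 j| < qm.2.+1%:R^-1].
(* Boxes leaving [V] are replaced by [set0], so the union ranges over a whole countable type. *)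
pose F qm : set (@vecM R d) := if asbool (box qm `<=` V) then box qm else set0.
have -> : V = \bigcup_qm F qm.
  apply/seteqP; split => [x Vx|x [qm _]]; last first.
    by rewrite /F; case: asboolP => // + bx; exact.
  have /nbhs_ballP[e e0 xeV] : nbhs x V by exact: open_nbhs_nbhs.
  (* Radius below [e / 2]: a point of the box is within two radii of [x], through the centre [q]. *)
  have [m] := @ltr_add_invr R 0 (e / 2) (divr_gt0 e0 (ltr0Sn R 1)).
  rewrite add0r => me.
  have /choice[q qx] : forall j : 'I_d, exists q : rat,
      `|ratr q - x 0 j| < m.+1%:R^-1.
    move=> j; have /rat_in_itvoo[q] : x 0 j < x 0 j + m.+1%:R^-1.
      by rewrite ltrDl invr_gt0.
    rewrite in_itv/= => /andP[q1 q2]; exists q.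
    by rewrite gtr0_norm ?subr_gt0// ltrBlDl.
  exists (\row_j q j, m) => //; rewrite /F; case: asboolP.
    by move=> _ j /=; rewrite mxE; exact: qx.
  case=> y /= yq; apply: xeV; split => // i j; rewrite ord1.
  rewrite /ball/=; apply: (@lt_trans _ _ (m.+1%:R^-1 + m.+1%:R^-1)).
    apply: le_lt_trans (ler_distD (ratr (q j)) _ _) _; apply: ltrD.
      by rewrite distrC; exact: qx.
    by have := yq j; rewrite mxE.
  by rewrite [ltRHS](splitr e); apply: ltrD.
apply: countable_bigcupT_measurable => // -[q m].
by rewrite /F; case: asboolP => // _; exact: measurable_box.
Qed.

Lemma continuous_measurable_vec (g : 'rV[R]_d -> R) :
  continuous g -> measurable_fun setT (g : @vecM R d -> R).
Proof.
move=> /continuousP cg; apply: (measurability _ (RGenOpens.measurableE R)).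
move=> _ [_ [a [b ->] <-]]; rewrite setTI; apply: open_measurable_vec.
exact/cg/interval_open.
Qed.

End vector_measurability.

(** * Smooth functions *)

Section euclidean.
Context {R : realType} {d : nat}.
Implicit Types x y v : 'rV[R]_d.

Definition dotv x y : R := \sum_(j < d) x 0 j * y 0 j.

Lemma sqnorm_ge0 x : 0 <= sqnorm x.
Proof. by apply: sumr_ge0 => j _; exact: sqr_ge0. Qed.

Lemma sqr_enorm x : enorm x ^+ 2 = sqnorm x.
Proof. by rewrite sqr_sqrtr//; exact: sqnorm_ge0. Qed.

Lemma enorm_ge0 x : 0 <= enorm x.
Proof. exact: sqrtr_ge0. Qed.

Lemma dotvv x : dotv x x = sqnorm x.
Proof. by apply: eq_bigr => j _; rewrite expr2. Qed.

Lemma dotvZr x a y : dotv x (a *: y) = a * dotv x y.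
Proof. by rewrite mulr_sumr; apply: eq_bigr => j _; rewrite mxE mulrCA. Qed.

Lemma dotvBl x y v : dotv (x - y) v = dotv x v - dotv y v.
Proof.
by rewrite -sumrN -big_split/=; apply: eq_bigr => j _; rewrite !mxE mulrBl.
Qed.

Lemma dotvDr x y v : dotv x (y + v) = dotv x y + dotv x v.
Proof. by rewrite -big_split/=; apply: eq_bigr => j _; rewrite mxE mulrDr. Qed.

Lemma dotvZl x a y : dotv (a *: x) y = a * dotv x y.
Proof. by rewrite mulr_sumr; apply: eq_bigr => j _; rewrite mxE mulrA. Qed.

Lemma dotv_suml n (u : 'I_n -> 'rV[R]_d) y :
  dotv (\sum_i u i) y = \sum_i dotv (u i) y.
Proof.
by rewrite exchange_big/=; apply: eq_bigr => j _; rewrite summxE mulr_suml.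
Qed.

Lemma sqnormD x y : sqnorm (x + y) = sqnorm x + 2 * dotv x y + sqnorm y.
Proof.
rewrite mulr_sumr -!big_split/=; apply: eq_bigr => j _; rewrite mxE; ring.
Qed.

Lemma sqnormZ a x : sqnorm (a *: x) = a ^+ 2 * sqnorm x.
Proof. by rewrite mulr_sumr; apply: eq_bigr => j _; rewrite mxE exprMn. Qed.

Lemma enormZ a x : 0 <= a -> enorm (a *: x) = a * enorm x.
Proof.
by move=> a0; rewrite /enorm sqnormZ sqrtrM ?sqr_ge0// sqrtr_sqr ger0_norm.
Qed.

Lemma coord_le_enorm x j : `|x 0 j| <= enorm x.
Proof.
rewrite -sqrtr_sqr ler_wsqrtr// /sqnorm (bigD1 j)//= lerDl.
by apply: sumr_ge0 => i _; exact: sqr_ge0.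
Qed.

Lemma sqnorm_eq0 x : (sqnorm x == 0) = (x == 0).
Proof.
apply/idP/eqP => [|->]; last by rewrite /sqnorm big1// => j _; rewrite mxE expr0n.
rewrite psumr_eq0 => [/allP h|j _]; last exact: sqr_ge0.
apply/rowP => j; rewrite mxE; apply/eqP.
by have := h j (mem_index_enum _); rewrite sqrf_eq0.
Qed.

(** Cauchy-Schwarz: expand the squared norm of [enorm y *: x - enorm x *: y] and divide by
    [2 * enorm x * enorm y], after treating zero vectors apart. *)
Lemma dotv_le_enorm x y : dotv x y <= enorm x * enorm y.
Proof.
have [->|x0] := eqVneq x 0.
  rewrite /dotv big1 => [|j _]; last by rewrite mxE mul0r.
  by rewrite mulr_ge0 ?enorm_ge0.
have [->|y0] := eqVneq y 0.
  rewrite /dotv big1 => [|j _]; last by rewrite mxE mulr0.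
  by rewrite mulr_ge0 ?enorm_ge0.
have pos (z : 'rV[R]_d) : z != 0 -> 0 < enorm z.
  by move=> z0; rewrite sqrtr_gt0 lt_def sqnorm_eq0 z0 sqnorm_ge0.
have : 0 <= sqnorm (enorm y *: x - enorm x *: y) by exact: sqnorm_ge0.
have -> : sqnorm (enorm y *: x - enorm x *: y) =
    enorm y ^+ 2 * sqnorm x + enorm x ^+ 2 * sqnorm y
    - 2 * (enorm x * enorm y) * dotv x y.
  rewrite !mulr_sumr -sumrN -!big_split/=; apply: eq_bigr => j _.
  by rewrite !mxE; ring.
rewrite -!sqr_enorm => h.
have xy0 : 0 < enorm x * enorm y by rewrite mulr_gt0 ?pos.
rewrite -(ler_pM2l xy0); nra.
Qed.

End euclidean.

(** * Gradients, the descent lemma and regularity *)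

Section calculus.
Context {R : realType} {d : nat}.
Implicit Types (f : 'rV[R]_d -> R) (x v : 'rV[R]_d).

Lemma derive_grad f x v : differentiable f x -> 'D_v f x = dotv (grad f x) v.
Proof.
move=> df; rewrite deriveE// {1}(row_sum_delta v) linear_sum.
by apply: eq_bigr => j _; rewrite linearZ/= mxE deriveE// mulrC.
Qed.

Lemma is_derive_line f x v (s : R) : differentiable f (x + s *: v) ->
  is_derive s 1 (fun s : R => f (x + s *: v)) (dotv (grad f (x + s *: v)) v).
Proof.
move=> df.
(* The difference quotient along the line is the directional quotient of [f] at [x + s *: v]. *)
have lineE : (fun h : R => h^-1 *: (((fun s => f (x + s *: v)) \o shift s) (h *: 1)
      - f (x + s *: v))) =
    (fun h : R => h^-1 *: ((f \o shift (x + s *: v)) (h *: v) - f (x + s *: v))).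
  apply/funext => h /=; congr (_ *: (f _ - _)).
  by rewrite [h *: 1]mulr1 scalerDl addrCA.
have dfv : derivable f (x + s *: v) v by exact: diff_derivable.
apply: DeriveDef; first by rewrite /derivable lineE.
by rewrite -derive_grad// /derive lineE.
Qed.

(** The gap between [f] and its quadratic model along the segment, [phi], is nonincreasing on the
    unit interval: Cauchy-Schwarz and the Lipschitz gradient make its derivative nonpositive.
    Compare [phi 1] with [phi 0]. *)
Lemma descent_lemma f L x v : Lsmooth f L -> 0 <= L ->
  f (x + v) <= f x + dotv (grad f x) v + L / 2 * sqnorm v.
Proof.
move=> [df Lf] L0.
pose phi (s : R) := f (x + s *: v) - s * dotv (grad f x) v
  - s ^+ 2 * (L / 2 * sqnorm v).
have dphi (s : R) : is_derive s 1 phi (dotv (grad f (x + s *: v)) v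
    - dotv (grad f x) v - 2 * s * (L / 2 * sqnorm v)).
  have h := is_derive_line (df (x + s *: v)).
  apply: is_derive_eq; rewrite /GRing.scale/=; ring.
have cphi : {within `[0, 1], continuous phi}.
  apply: derivable_within_continuous => s _; exact: ex_derive.
have : phi 1 <= phi 0.
  apply: (@ler0_derive1_le_cc _ phi 0 1) => //; rewrite ?in_itv/= ?lexx ?ler01//.
  move=> s; rewrite in_itv/= => /andP[s0 s1].
  rewrite derive1E derive_val -dotvBl subr_le0.
  apply: le_trans (dotv_le_enorm _ _) _.
  have := Lf (x + s *: v) x; rewrite [X in L * enorm X]addrAC subrr add0r enormZ ?(ltW s0)// => h.
  apply: le_trans (ler_wpM2r (enorm_ge0 _) h) _.
  by rewrite -sqr_enorm; lra.
by rewrite /phi !scale1r !scale0r addr0; lra.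
Qed.

(** A gradient step of length [L^-1] lowers [f] by at least [sqnorm (grad f x) / (2 * L)] and cannot
    go below [fmin]. *)
Lemma grad_sqnorm_le f L fmin x z : Lsmooth f L -> 0 <= L ->
  (forall y, fmin <= f y) -> grad f z = 0 ->
  sqnorm (grad f x) <= 2 * L * (f x - fmin).
Proof.
move=> Lf L0 fmin_le gz.
(* For [L = 0] the gradient is constant, so it vanishes everywhere as it does at [z]. *)
have [L00|Ln0] := eqVneq L 0.
  have := Lf.2 x z; rewrite L00 gz subr0 mul0r => h.
  have -> : sqnorm (grad f x) = 0.
    by rewrite -sqr_enorm; apply/eqP; rewrite sqrf_eq0 eq_le h enorm_ge0.
  by rewrite mulr0 mul0r.
have Lp : 0 < L by rewrite lt_def Ln0.
have := descent_lemma x (- L^-1 *: grad f x) Lf L0.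
rewrite dotvZr dotvv sqnormZ => h.
have := le_trans (fmin_le _) h.
have -> : L / 2 * ((- L^-1) ^+ 2 * sqnorm (grad f x)) = L^-1 / 2 * sqnorm (grad f x).
  by field.
move=> {}h; have {}h : L^-1 * (sqnorm (grad f x) / 2) <= f x - fmin by lra.
have := ler_wpM2l L0 h; rewrite mulrA mulfV// mul1r; lra.
Qed.

Lemma enorm_continuous : continuous (@enorm R d).
Proof.
move=> x; apply: continuous_comp; last exact: sqrt_continuous.
rewrite /sqnorm; apply: cvg_big => //=; last first.
  move=> j _; exact: (continuous_comp (@coord_continuous R 1 d 0 j x) (@exprn_continuous R 2 (x 0 j))).
  exact: (nbhs_filter x).
exact: add_continuous.
Qed.

(** Each coordinate difference is at most [L * enorm (y - x)], which tends to 0. This gives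
    measurability of gradients at random points. *)
Lemma grad_coord_continuous f L j : Lsmooth f L ->
  continuous (fun x => grad f x 0 j).
Proof.
move=> [_ Lf] x.
have e0 : (fun y => L * enorm (y - x)) @ x --> (0 : R).
  have -> : (0 : R) = L * enorm (x - x).
    by rewrite subrr /enorm (eqP (_ : sqnorm 0 == 0)) ?sqnorm_eq0// sqrtr0 mulr0.
  apply: cvgMl_tmp; first exact: (nbhs_filter x).
  apply: (@continuous_comp _ _ _ (fun y : 'rV[R]_d => y - x) (@enorm R d) x).
    apply: cvgB; first exact: (nbhs_filter x).
      by move=> A; exact.
    exact: (@cvg_cst _ _ _ _ (nbhs_filter x)).
  exact: enorm_continuous.
have FF := nbhs_filter x.
apply/(@cvgrPdist_lt _ _ _ _ FF) => e e_gt0.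
move/(@cvgrPdist_lt _ _ _ _ FF) : e0 => /(_ _ e_gt0).
apply: (@filterS _ _ FF) => y.
rewrite sub0r normrN; apply: le_lt_trans.
apply: le_trans (ler_norm _); apply: le_trans (Lf y x).
have := coord_le_enorm (grad f y - grad f x) j.
by rewrite [X in `|X|]mxE [X in _ + X]mxE distrC.
Qed.

Lemma continuous_Tmap (a : R) (xi : 'rV[R]_d) : continuous (Tmap a xi).
Proof.
move=> x; have FF := nbhs_filter x.
apply: cvgD; last exact: (@cvg_cst _ _ _ _ FF).
by apply: (@cvgZl_tmp _ _ _ _ FF) => A; exact.
Qed.

Lemma Lsmooth_continuous f L : Lsmooth f L -> continuous f.
Proof. by move=> [df _] x; exact: differentiable_continuous. Qed.

(** [Tmap] is affine with linear part [a], so moving along [v] moves its image along [a *: v]. *)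
Lemma is_derive_Tmap f a (xi : 'rV[R]_d) x v : differentiable f (Tmap a xi x) ->
  is_derive x v (f \o Tmap a xi) (a * 'D_v f (Tmap a xi x)).
Proof.
move=> df.
have TE : (fun h : R => h^-1 *: (((f \o Tmap a xi) \o shift x) (h *: v)
      - (f \o Tmap a xi) x)) =
    (fun h : R => h^-1 *: ((f \o shift (Tmap a xi x)) (h *: (a *: v)) - f (Tmap a xi x))).
  apply/funext => h /=; congr (_ *: (f _ - _)).
  by rewrite /Tmap scalerDr addrA !scalerA mulrC.
have dfv : derivable f (Tmap a xi x) (a *: v) by exact: diff_derivable.
apply: DeriveDef; first by rewrite /derivable TE.
have -> : a * 'D_v f (Tmap a xi x) = 'D_(a *: v) f (Tmap a xi x).
  by rewrite !deriveE// linearZ.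
by rewrite /derive TE.
Qed.

Lemma grad_ftilde n (f : 'I_n -> 'rV[R]_d -> R) alpha xs x :
  (forall i x, differentiable (f i) x) ->
  grad (ftilde f alpha xs) x =
  n%:R^-1 *: \sum_(i < n) alpha i *: grad (f i) (Tmap (alpha i) (xs i) x).
Proof.
move=> df; apply/rowP => j; rewrite !mxE summxE.
have -> : ftilde f alpha xs =
    n%:R^-1 *: \sum_(i < n) (f i \o Tmap (alpha i) (xs i)).
  by apply/funext => y; rewrite /ftilde fctE fct_sumE.
have h i : is_derive x (delta_mx 0 j : 'rV[R]_d) (f i \o Tmap (alpha i) (xs i))
    (alpha i * 'D_(delta_mx 0 j) (f i) (Tmap (alpha i) (xs i) x)).
  exact: is_derive_Tmap.
rewrite derive_val; congr (_ * _).
by apply: eq_bigr => i _; rewrite !mxE.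
Qed.

End calculus.

(** * Variance of the averaged compressors *)

Section sum_of_independent.
Context {R : realType} {I : choiceType} {dO dS} {O : measurableType dO}
  {S : measurableType dS} (P : probability O R) (xi : I -> O -> S).
Hypothesis Ixi : mutually_independent P xi.
Variable psi : I -> S -> R.
Hypothesis mpsi : forall i, measurable_fun setT (psi i).

(** Induction on [s]: the head depends on [xi i] alone, the rest on the samples indexed by the tail,
    and these two sigma-algebras are independent. *)
Lemma integral_sqr_sum_indep (s : seq I) : uniq s ->
  (forall i, i \in s -> [/\ P.-integrable setT (fun w => (psi i (xi i w))%:E),
    P.-integrable setT (fun w => (psi i (xi i w) ^+ 2)%:E) &
    \int[P]_w (psi i (xi i w))%:E = 0]%E) ->
  (\int[P]_w ((\sum_(i <- s) psi i (xi i w)) ^+ 2)%:E =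
   \sum_(i <- s) \int[P]_w (psi i (xi i w) ^+ 2)%:E)%E.
Proof.
elim: s => [_ _|i s IH /= /andP[iNs us] H].
  rewrite big_nil; under eq_integral do rewrite big_nil expr0n.
  by rewrite integral0.
have [i1 i2 i0] := H i (mem_head _ _).
rewrite big_cons -IH//; last by move=> k ks; apply: H; rewrite inE ks orbT.
have mxiK (K : set I) k : K k ->
    measurable_fun setT (fun w : cylType xi K => psi k (xi k w)).
  by move=> Kk; apply: measurableT_comp => //; exact: measurable_cyl.
rewrite addeC.
under eq_integral do rewrite big_cons addrC.
apply: (@integral_sqr_add_indep R _ _ _ O (cylType xi [set` s])
  (cylType xi [set i]) P id id
  (fun w => \sum_(k <- s) psi k (xi k w)) (fun w => psi i (xi i w))) => //.
- exact: (cyl_measurable Ixi).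
- exact: (cyl_measurable Ixi).
- apply: indep_cyl => //; apply/seteqP; split => // k /= [ks ki].
  by rewrite ki (negPf iNs) in ks.
(* Generalised to sublists [s'], so that the sigma-algebra stays the one of [s] during the
   induction. *)
- suff h (s' : seq I) : {subset s' <= s} -> measurable_fun setT
      (fun w : cylType xi [set` s] => \sum_(k <- s') psi k (xi k w)) by exact: h.
  elim: s' => [|k s' IHs] h.
    rewrite [X in measurable_fun _ X](_ : _ = cst 0); first exact: measurable_cst.
    by apply/funext => w; rewrite big_nil.
  rewrite [X in measurable_fun _ X](_ : _ = (fun w => psi k (xi k w)) \+
      (fun w => \sum_(l <- s') psi l (xi l w))); last first.
    by apply/funext => w; rewrite big_cons.
  apply: measurable_funD.
    by apply: mxiK => /=; apply: h; rewrite mem_head.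
  by apply: IHs => k' k's; apply: h; rewrite inE k's orbT.
- exact: mxiK.
Qed.

End sum_of_independent.

(** * Mean and second moment of the averaged compression error *)

Section averaged_noise.
Context {R : realType} {d n : nat} {dO dS} {O : measurableType dO}
  {S : measurableType dS} (P : probability O R) (xi : 'I_n * nat -> O -> S).
Hypothesis Ixi : mutually_independent P xi.
Variables (t : nat) (C : 'I_n -> S -> 'rV[R]_d) (g : 'I_n -> 'rV[R]_d) (v : 'I_n -> R).
Hypothesis mC : forall i j, measurable_fun setT (fun s => C i s 0 j).
Hypothesis iC : forall i j, P.-integrable setT (fun w => (C i (xi (i, t) w) 0 j)%:E).
Hypothesis EC : forall i j, (\int[P]_w (C i (xi (i, t) w) 0 j)%:E = (g i 0 j)%:E)%E.
Hypothesis VC : forall i, (\int[P]_w (sqnorm (C i (xi (i, t) w) - g i))%:E <= (v i)%:E)%E.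

Definition avg_noise (w : O) : 'rV[R]_d :=
  n%:R^-1 *: \sum_(i < n) (C i (xi (i, t) w) - g i).

(** Coordinate [j] of one client's error, indexed by pairs to match the independent family [xi]. *)
Let psi j (p : 'I_n * nat) (s : S) := C p.1 s 0 j - g p.1 0 j.

Let mpsi j p : measurable_fun setT (psi j p).
Proof. by apply: measurable_funB => //; exact: measurable_cst. Qed.

Let mpsixi j i : measurable_fun setT (fun w => psi j (i, t) (xi (i, t) w)).
Proof. by apply: measurableT_comp => //; exact: (Ixi.1 (i, t)). Qed.

Let ipsi j i : P.-integrable setT (fun w => (psi j (i, t) (xi (i, t) w))%:E).
Proof.
under eq_fun do rewrite EFinB.
by apply: integrableB => //; exact: finite_measure_integrable_cst.
Qed.

Let Epsi j i : (\int[P]_w (psi j (i, t) (xi (i, t) w))%:E = 0)%E.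
Proof.
under eq_integral do rewrite EFinB.
rewrite integralB//; last exact: finite_measure_integrable_cst.
by rewrite EC integral_prob_cst subee.
Qed.

Let sqnorm_psi i w : sqnorm (C i (xi (i, t) w) - g i) =
  \sum_(j < d) psi j (i, t) (xi (i, t) w) ^+ 2.
Proof. by apply: eq_bigr => j _; rewrite !mxE. Qed.

Let mpsi2 j i : measurable_fun setT (fun w => (psi j (i, t) (xi (i, t) w) ^+ 2)%:E).
Proof. by apply/measurable_EFinP; exact: measurable_funX. Qed.

(** One squared coordinate is at most the squared norm, whose expectation is bounded by the finite
    [v i]. *)
Let ipsi2 j i : P.-integrable setT (fun w => (psi j (i, t) (xi (i, t) w) ^+ 2)%:E).
Proof.
apply/integrableP; split => //.
apply: le_lt_trans (ltry (v i)); apply: le_trans (VC i).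
apply: ge0_le_integral => //.
- exact: measurableT_comp.
- under eq_fun do rewrite sqnorm_psi -sumEFin.
  exact: emeasurable_sum.
- move=> w _; rewrite sqnorm_psi gee0_abs lee_fin ?sqr_ge0//.
  by rewrite (bigD1 j)//= lerDl; apply: sumr_ge0 => k _; exact: sqr_ge0.
Qed.

Lemma avg_noise_coord j w : avg_noise w 0 j =
  n%:R^-1 * \sum_(i < n) psi j (i, t) (xi (i, t) w).
Proof. by rewrite mxE summxE; congr (_ * _); apply: eq_bigr => i _; rewrite !mxE. Qed.

Lemma integrable_avg_noise j : P.-integrable setT (fun w => (avg_noise w 0 j)%:E).
Proof.
under eq_fun do rewrite avg_noise_coord EFinM -sumEFin.
by apply: integrableZl => //; exact: integrable_sum.
Qed.

Lemma integral_avg_noise j : (\int[P]_w (avg_noise w 0 j)%:E = 0)%E.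
Proof.
under eq_integral do rewrite avg_noise_coord EFinM -sumEFin.
rewrite integralZl//; last exact: integrable_sum.
rewrite integral_sum//= big1 ?mule0// => i _; exact: Epsi.
Qed.

(** In each coordinate, independence across clients makes second moments add up, and the averaging
    factor is squared. *)
Lemma integral_sqnorm_avg_noise :
  (\int[P]_w (sqnorm (avg_noise w))%:E <= (n%:R ^- 2 * \sum_(i < n) v i)%:E)%E.
Proof.
under eq_integral do rewrite /sqnorm -sumEFin.
rewrite ge0_integral_sum//=; last 2 first.
- move=> j; apply/measurable_EFinP; apply: measurable_funX.
  by have /integrableP[/measurable_EFinP] := integrable_avg_noise j.
- by move=> j w _; rewrite lee_fin sqr_ge0.
have coordE j : (\int[P]_w (avg_noise w 0 j ^+ 2)%:E =
    (n%:R ^- 2)%:E * \sum_(i < n) \int[P]_w (psi j (i, t) (xi (i, t) w) ^+ 2)%:E)%E.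
  under eq_integral do rewrite avg_noise_coord exprMn exprVn EFinM.
  have := @integral_sqr_sum_indep R _ _ _ O S P xi Ixi (psi j) (mpsi j)
    [seq (i, t) | i <- index_enum 'I_n].
  rewrite big_map => <-.
  - rewrite ge0_integralZl//.
    + by under [in RHS]eq_integral do rewrite big_map.
    + by apply/measurable_EFinP; apply: measurable_funX; exact: measurable_sum.
    + by move=> w _; rewrite lee_fin sqr_ge0.
  - by rewrite map_inj_uniq ?index_enum_uniq// => i i' [].
  - by move=> _ /mapP[i _ ->]; split.
rewrite (eq_bigr _ (fun j _ => coordE j)) -ge0_sume_distrr; last first.
  move=> j _; apply: sume_ge0 => i _; apply: integral_ge0 => w _.
  by rewrite lee_fin sqr_ge0.
rewrite EFinM; apply: lee_wpmul2l; first by rewrite lee_fin invr_ge0 exprn_ge0.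
(* Summing over coordinates first reassembles the squared norm of each client's error. *)
rewrite exchange_big/= -sumEFin; apply: lee_sum => i _.
apply: le_trans (VC i); rewrite -ge0_integral_sum//.
  by under eq_integral do rewrite sumEFin -sqnorm_psi.
by move=> j w _; rewrite lee_fin sqr_ge0.
Qed.

End averaged_noise.

(** * One step and telescoping *)

Section compressed_gradient_step.
Context {R : realType} {d n : nat}.
Variables (f : 'I_n -> 'rV[R]_d -> R) (L fstar : 'I_n -> R)
  (xs : 'I_n -> 'rV[R]_d) (alpha om : 'I_n -> R) (gamma : R).
Hypothesis Lf : forall i, 0 <= L i /\ Lsmooth (f i) (L i).
Hypothesis fmin : forall i y, fstar i <= f i y.
Hypothesis grad_xs : forall i, grad (f i) (xs i) = 0.
Hypothesis om_ge0 : forall i, 0 <= om i.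
Hypothesis gamma_gt0 : 0 < gamma.

Let Lalpha := n%:R^-1 * \sum_(i < n) alpha i ^+ 2 * L i.
Let favg := n%:R^-1 * \sum_(i < n) fstar i.
(** The terms are nonnegative, so the default 0 is neutral; it also gives [0 <= M] directly. *)
Let M := \big[Num.max/0]_(i < n) (L i * om i * alpha i ^+ 2).
Let ft := ftilde f alpha xs.

Definition local_grad (i : 'I_n) (x : 'rV[R]_d) :=
  alpha i *: grad (f i) (Tmap (alpha i) (xs i) x).

Lemma grad_ftilde_local x :
  grad ft x = n%:R^-1 *: \sum_(i < n) local_grad i x.
Proof. by apply: grad_ftilde => i y; exact: (Lf i).2.1. Qed.

Lemma Lalpha_ge0 : 0 <= Lalpha.
Proof.
rewrite mulr_ge0 ?invr_ge0//; apply: sumr_ge0 => i _.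
by rewrite mulr_ge0 ?sqr_ge0// (Lf i).1.
Qed.

(** Average of the descent lemmas of the [f i] at [Tmap (alpha i) (xs i) x] with displacement
    [alpha i *: v]. *)
Lemma ftilde_descent x v :
  ft (x + v) <= ft x + dotv (grad ft x) v + Lalpha / 2 * sqnorm v.
Proof.
rewrite grad_ftilde_local dotvZl dotv_suml /Lalpha /ft /ftilde.
have -> : n%:R^-1 * (\sum_(i < n) alpha i ^+ 2 * L i) / 2 * sqnorm v =
    n%:R^-1 * \sum_(i < n) L i / 2 * sqnorm (alpha i *: v).
  rewrite -!mulrA; congr (_ * _); rewrite mulr_suml; apply: eq_bigr => i _.
  by rewrite sqnormZ; ring.
rewrite -!mulrDr -!big_split/= ler_wpM2l ?invr_ge0//; apply: ler_sum => i _.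
have -> : Tmap (alpha i) (xs i) (x + v) = Tmap (alpha i) (xs i) x + alpha i *: v.
  by rewrite /Tmap scalerDr addrAC.
have [L0 Li] := Lf i.
by rewrite dotvZl -dotvZr; exact: descent_lemma.
Qed.

Lemma favg_le_ftilde x : favg <= ft x.
Proof. by rewrite ler_wpM2l ?invr_ge0//; apply: ler_sum. Qed.

Lemma compression_variance_le x :
  n%:R ^- 2 * \sum_(i < n) om i * sqnorm (local_grad i x) <=
  2 * M / n%:R * (ft x - favg).
Proof.
(* One factor [n%:R^-1] is the averaging inside [ft x - favg], so the comparison can be made client
   by client. *)
have -> : 2 * M / n%:R * (ft x - favg) = n%:R ^- 2 *
    \sum_(i < n) 2 * M * (f i (Tmap (alpha i) (xs i) x) - fstar i).
  rewrite -mulr_sumr sumrB /ft /ftilde /favg -exprVn; ring.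
rewrite ler_wpM2l ?invr_ge0 ?exprn_ge0//; apply: ler_sum => i _.
set D := _ - fstar i.
have D0 : 0 <= D by rewrite subr_ge0.
have [L0 Li] := Lf i.
have gi : sqnorm (grad (f i) (Tmap (alpha i) (xs i) x)) <= 2 * L i * D.
  exact: grad_sqnorm_le Li L0 (fmin i) (grad_xs i).
have LM : L i * om i * alpha i ^+ 2 <= M by exact: le_bigmax.
rewrite sqnormZ; apply: (@le_trans _ _ (om i * (alpha i ^+ 2 * (2 * L i * D)))).
  by rewrite ler_wpM2l// ler_wpM2l ?sqr_ge0.
have := ler_wpM2r D0 LM; lra.
Qed.

Lemma continuous_ftilde : continuous ft.
Proof.
move=> x; have FF := nbhs_filter x.
apply: (@cvgMl_tmp _ _ _ FF); rewrite /=.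
apply: cvg_big => //; first exact: add_continuous.
move=> i _; apply: (@continuous_comp _ _ _ (Tmap (alpha i) (xs i)) (f i) x).
  exact: continuous_Tmap.
exact: (Lsmooth_continuous (Lf i).2).
Qed.

Lemma measurable_ftilde : measurable_fun setT (ft : @vecM R d -> R).
Proof. exact: continuous_measurable_vec continuous_ftilde. Qed.

Lemma measurable_local_grad i :
  measurable_fun setT (local_grad i : @vecM R d -> @vecM R d).
Proof.
apply: measurable_vecP => j.
rewrite [X in measurable_fun _ X](_ : _ = (fun x : @vecM R d =>
    alpha i * grad (f i) (Tmap (alpha i) (xs i) x) 0 j)); last first.
  by apply/funext => x; rewrite /local_grad mxE.
apply: measurable_funM; first exact: measurable_cst.
apply: continuous_measurable_vec => x.
apply: (@continuous_comp _ _ _ (Tmap (alpha i) (xs i)) (fun y => grad (f i) y 0 j) x).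
  exact: continuous_Tmap.
exact: (grad_coord_continuous (Lf i).2).
Qed.

Lemma measurable_sqnorm_grad_ftilde :
  measurable_fun setT (fun x : @vecM R d => sqnorm (grad ft x)).
Proof.
rewrite /sqnorm; apply: measurable_sum => j; apply: measurable_funX.
rewrite [X in measurable_fun _ X](_ : _ = (fun x : @vecM R d =>
    n%:R^-1 * \sum_(i < n) local_grad i x 0 j)); last first.
  by apply/funext => x; rewrite grad_ftilde_local mxE summxE.
apply: measurable_funM; first exact: measurable_cst.
apply: measurable_sum => i.
exact: (measurableT_comp (measurable_coord j) (measurable_local_grad i)).
Qed.

Context {dO dS} {O : measurableType dO} {S : measurableType dS}
  (P : probability O R).
Variables (xi : 'I_n -> nat -> O -> S) (c : 'I_n -> nat -> S -> 'rV[R]_d -> 'rV[R]_d).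
Hypothesis Ixi : mutually_independent P (fun p : 'I_n * nat => xi p.1 p.2).
Hypothesis mc : forall i t, measurable_fun setT
     (fun p : (S * @vecM R d)%type => (c i t p.1 p.2 : @vecM R d)).
Hypothesis Bc : forall i t, in_B P (fun w => c i t (xi i t w)) (om i).

(** Samples and point are separate arguments, so the point can be frozen while the samples are
    averaged. *)
Definition cgd_step t (s : 'I_n -> S) (x : 'rV[R]_d) : 'rV[R]_d :=
  x - gamma *: (n%:R^-1 *: \sum_(i < n) c i t (s i) (local_grad i x)).

Lemma measurable_cgd_step t {dT} {T : measurableType dT}
    (Z : 'I_n -> T -> S) (Y : T -> @vecM R d) :
  (forall i, measurable_fun setT (Z i)) -> measurable_fun setT Y ->
  measurable_fun setT (fun z => cgd_step t (fun i => Z i z) (Y z) : @vecM R d).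
Proof.
move=> mZ mY; apply: measurable_vecP => j.
rewrite [X in measurable_fun _ X](_ : _ = (fun z => Y z 0 j -
    gamma * (n%:R^-1 * \sum_(i < n) c i t (Z i z) (local_grad i (Y z)) 0 j))); last first.
  by apply/funext => z; rewrite /cgd_step !mxE summxE.
apply: measurable_funB; first exact: (measurableT_comp (measurable_coord j) mY).
apply: measurable_funM; first exact: measurable_cst.
apply: measurable_funM; first exact: measurable_cst.
apply: measurable_sum => i.
apply: (measurableT_comp (measurable_coord j)).
have mg := measurableT_comp (measurable_local_grad i) mY.
exact: (measurableT_comp (mc i t) (measurable_fun_pair (mZ i) mg)).
Qed.

Hypothesis gammaL : gamma * Lalpha <= 1.

Lemma expected_descent t x :
  (\int[P]_w (ft (cgd_step t (fun i => xi i t w) x) - favg)%:E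
   + (gamma / 2 * sqnorm (grad ft x))%:E <=
   ((1 + 2 * Lalpha * gamma ^+ 2 * M / n%:R) * (ft x - favg))%:E)%E.
Proof.
pose C i s := c i t s (local_grad i x).
pose g i := local_grad i x.
pose v i := om i * sqnorm (g i).
have mC i j : measurable_fun setT (fun s => C i s 0 j).
  apply: (measurableT_comp (measurable_coord j)).
  have mg : measurable_fun [set: S] (cst (g i : @vecM R d)) by exact: measurable_cst.
  exact: (measurableT_comp (mc i t) (measurable_fun_pair (@measurable_id _ S setT) mg)).
have iC i j : P.-integrable setT (fun w => (C i (xi i t w) 0 j)%:E).
  by have [] := Bc i t (g i).
have EC i j : (\int[P]_w (C i (xi i t w) 0 j)%:E = (g i 0 j)%:E)%E.
  by have [_ []] := Bc i t (g i).
have VC i : (\int[P]_w (sqnorm (C i (xi i t w) - g i))%:E <= (v i)%:E)%E.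
  by have [_ []] := Bc i t (g i).
pose N := avg_noise (fun p : 'I_n * nat => xi p.1 p.2) t C g.
have iN j : P.-integrable setT (fun w => (N w 0 j)%:E).
  exact: integrable_avg_noise.
have EN j : (\int[P]_w (N w 0 j)%:E = 0)%E.
  exact: integral_avg_noise.
have VN := integral_sqnorm_avg_noise Ixi mC iC EC VC.
pose G := grad ft x.
have stepE w : cgd_step t (fun i => xi i t w) x = x - gamma *: (G + N w).
  rewrite /cgd_step /G grad_ftilde_local -scalerDr -big_split/=.
  by congr (_ - _ *: (_ *: _)); apply: eq_bigr => i _; rewrite addrC subrK.
(* Expanding the descent bound at [- gamma *: (G + N w)]: [kappa] multiplies the squared norms, [A]
   collects the deterministic terms and [b] pairs with the centred noise. *)
pose kappa := Lalpha * gamma ^+ 2 / 2.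
have kappa0 : 0 <= kappa.
  by rewrite divr_ge0// mulr_ge0 ?sqr_ge0// Lalpha_ge0.
pose A := ft x - favg - gamma * sqnorm G + kappa * sqnorm G.
pose b := (2 * kappa - gamma) *: G.
have ptw w : ft (cgd_step t (fun i => xi i t w) x) - favg <=
    A + dotv b (N w) + kappa * sqnorm (N w).
  have := ftilde_descent x (- gamma *: (G + N w)).
  rewrite -/G stepE scaleNr -scaleNr dotvZr dotvDr dotvv sqnormZ sqnormD.
  rewrite /A /b dotvZl /kappa; lra.
have ilin : P.-integrable setT (fun w => (dotv b (N w))%:E).
  rewrite /dotv; under eq_fun do rewrite -sumEFin.
  apply: integrable_sum => // j _.
  by under eq_fun do rewrite EFinM; exact: integrableZl.
have Elin : (\int[P]_w (dotv b (N w))%:E = 0)%E.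
  rewrite /dotv; under eq_integral do rewrite -sumEFin.
  rewrite integral_sum//=; last first.
    by move=> j; under eq_fun do rewrite EFinM; exact: integrableZl.
  rewrite big1// => j _; under eq_integral do rewrite EFinM.
  by rewrite integralZl// EN mule0.
have msqN : measurable_fun setT (fun w => sqnorm (N w)).
  rewrite /sqnorm; apply: measurable_sum => j; apply: measurable_funX.
  by have /integrableP[/measurable_EFinP] := iN j.
have sqN0 w : (0 <= (sqnorm (N w))%:E)%E by rewrite lee_fin sqnorm_ge0.
have isq : P.-integrable setT (fun w => (sqnorm (N w))%:E).
  apply/integrableP; split; first exact/measurable_EFinP.
  under eq_integral do rewrite gee0_abs//.
  by apply: le_lt_trans VN _; exact: ltry.
have mstep : measurable_fun setT (fun w => ft (cgd_step t (fun i => xi i t w) x) - favg).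
  apply: measurable_funB; last exact: measurable_cst.
  apply: (measurableT_comp measurable_ftilde).
  apply: (@measurable_cgd_step t _ O (fun i => xi i t) (fun=> x)).
    by move=> i; exact: (Ixi.1 (i, t)).
  exact: measurable_cst.
have ub : (\int[P]_w (ft (cgd_step t (fun i => xi i t w) x) - favg)%:E <=
    A%:E + kappa%:E * \int[P]_w (sqnorm (N w))%:E)%E.
  apply: (@le_trans _ _ (\int[P]_w (A + dotv b (N w) + kappa * sqnorm (N w))%:E)%E).
    (* Subtracting [favg] makes the left integrand nonnegative, so monotonicity of the integral
       applies. *)
    apply: ge0_le_integral => //.
    - by move=> w _; rewrite lee_fin subr_ge0 favg_le_ftilde.
    - exact/measurable_EFinP.
    - apply/measurable_EFinP; apply: measurable_funD; last first.
        by apply: measurable_funM => //; exact: measurable_cst.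
      apply: measurable_funD; first exact: measurable_cst.
      by have /integrableP[/measurable_EFinP] := ilin.
    - by move=> w _; rewrite lee_fin ptw.
  under eq_integral do rewrite EFinD EFinD EFinM.
  have icst : P.-integrable setT (fun=> A%:E) by exact: finite_measure_integrable_cst.
  rewrite integralD//=; [|exact: integrableD|exact: integrableZl].
  by rewrite integralD// Elin adde0 integral_prob_cst integralZl.
have f1 : (\int[P]_w (sqnorm (N w))%:E)%E \is a fin_num by exact: integrable_fin_num.
move: ub VN; rewrite -(fineK f1) -EFinM -EFinD => ub VN.
apply: le_trans (leeD2r _ ub) _.
rewrite -EFinD lee_fin; move: VN; rewrite lee_fin => VN.
have := le_trans VN (compression_variance_le x) => {}VN.
have D0 : 0 <= ft x - favg by rewrite subr_ge0 favg_le_ftilde.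
have := ler_wpM2l kappa0 VN.
(* The step-size condition: half of the decrease [gamma * sqnorm G] pays for the quadratic term, the
   other half remains. *)
have kg : kappa * sqnorm G <= gamma / 2 * sqnorm G.
  rewrite ler_wpM2r ?sqnorm_ge0//.
  have := ler_wpM2l (ltW gamma_gt0) gammaL; rewrite /kappa; lra.
(* The noise costs [kappa * (2 * M / n%:R)] times the gap, half of the stated increment; [extra] is
   the other half. *)
have extra : 0 <= Lalpha * gamma ^+ 2 * (M / n%:R) * (ft x - favg).
  apply: mulr_ge0 => //; apply: mulr_ge0.
    by apply: mulr_ge0; [exact: Lalpha_ge0|exact: sqr_ge0].
  by apply: divr_ge0 => //; exact: bigmax_ge_id.
rewrite /A -/G {2}/kappa; lra.
Qed.

End compressed_gradient_step.

(** * Adapted iterates and the telescoped bound *)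

Section compressed_gradient_descent.
Context {R : realType} {d n : nat}.
Variables (f : 'I_n -> 'rV[R]_d -> R) (L fstar : 'I_n -> R)
  (xs : 'I_n -> 'rV[R]_d) (alpha om : 'I_n -> R) (gamma : R).
Hypothesis Lf : forall i, 0 <= L i /\ Lsmooth (f i) (L i).
Hypothesis fmin : forall i y, fstar i <= f i y.
Hypothesis grad_xs : forall i, grad (f i) (xs i) = 0.
Hypothesis om_ge0 : forall i, 0 <= om i.
Hypothesis gamma_gt0 : 0 < gamma.

Let Lalpha := n%:R^-1 * \sum_(i < n) alpha i ^+ 2 * L i.
Let favg := n%:R^-1 * \sum_(i < n) fstar i.
Let M := \big[Num.max/0]_(i < n) (L i * om i * alpha i ^+ 2).
Let ft := ftilde f alpha xs.
Hypothesis gammaL : gamma * Lalpha <= 1.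

Context {dO dS} {O : measurableType dO} {S : measurableType dS}
  (P : probability O R).
Variables (xi : 'I_n -> nat -> O -> S) (c : 'I_n -> nat -> S -> 'rV[R]_d -> 'rV[R]_d).
Let xip (p : 'I_n * nat) := xi p.1 p.2.
Hypothesis Ixi : mutually_independent P xip.
Hypothesis mc : forall i t, measurable_fun setT
     (fun p : (S * @vecM R d)%type => (c i t p.1 p.2 : @vecM R d)).
Hypothesis Bc : forall i t, in_B P (fun w => c i t (xi i t w)) (om i).
Variables (x0 : 'rV[R]_d) (X : nat -> O -> 'rV[R]_d).
Hypothesis X0 : forall w, X 0%N w = x0.
Hypothesis XS : forall t w,
  X t.+1 w = cgd_step f xs alpha gamma c t (fun i => xi i t w) (X t w).

(** The inequality is strict: [X t] is built from the samples of iterations before [t], and those of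
    iteration [t] form [present t]. *)
Let past t := cylType xip [set p | (p.2 < t)%N].
Let present t := cylType xip [set p | p.2 = t].

(** By induction, [X t.+1] is a measurable function of [X t] and the samples at [t], all visible in
    [past t.+1]. *)
Lemma adapted_cgd t : measurable_fun setT (X t : past t -> @vecM R d).
Proof.
elim: t => [|t IH].
  by rewrite (_ : X 0%N = cst x0); [exact: measurable_cst|exact/funext].
rewrite (_ : X t.+1 = fun w =>
    cgd_step f xs alpha gamma c t (fun i => xi i t w) (X t w)); last exact/funext.
apply: (measurable_cgd_step xs alpha gamma Lf mc).
- move=> i; apply: (@measurable_cyl _ _ _ _ _ xip _ (i, t)) => /=; exact: ltnSn.
- apply: (measurableT_comp IH (g := id : past t.+1 -> past t)).
  by apply: cyl_sub => p /= /ltnW.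
Qed.

Lemma measurable_cgd t : measurable_fun setT (X t : O -> @vecM R d).
Proof.
have mid : measurable_fun setT (id : O -> past t) by exact: (cyl_measurable Ixi).
exact: (measurableT_comp (@adapted_cgd t) mid).
Qed.

Let gap t := (\int[P]_w (ft (X t w) - favg)%:E)%E.
Let sqgrad t := (\int[P]_w (gamma / 2 * sqnorm (grad ft (X t w)))%:E)%E.
Let a := 2 * Lalpha * gamma ^+ 2 * M / n%:R.

Let a_ge0 : 0 <= a.
Proof.
apply: divr_ge0 => //; apply: mulr_ge0; last exact: bigmax_ge_id.
apply: mulr_ge0; last exact: sqr_ge0.
by apply: mulr_ge0 => //; exact: (Lalpha_ge0 _ Lf).
Qed.

Let mgap : measurable_fun setT (fun x : @vecM R d => ft x - favg).
Proof.
by apply: measurable_funB; [exact: measurable_ftilde|exact: measurable_cst].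
Qed.

Let gap_ge0 x : 0 <= ft x - favg.
Proof. by rewrite subr_ge0 favg_le_ftilde. Qed.

Lemma expected_descent_cgd t : (gap t.+1 + sqgrad t <= (1 + a)%:E * gap t)%E.
Proof.
(* The iterate reads the first component and the fresh samples the second, so independence lets the
   iterate be frozen. *)
pose h (z : past t * present t) :=
  (ft (cgd_step f xs alpha gamma c t (fun i => xi i t z.2) (X t z.1)) - favg)%:E.
have mstep dT (T : measurableType dT) (Y : T -> @vecM R d) (Z : 'I_n -> T -> S) :
    measurable_fun setT Y -> (forall i, measurable_fun setT (Z i)) ->
    measurable_fun setT (fun z =>
      (ft (cgd_step f xs alpha gamma c t (fun i => Z i z) (Y z)) - favg)%:E).
  move=> mY mZ; apply/measurable_EFinP; apply: (measurableT_comp mgap).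
  by apply: (measurable_cgd_step xs alpha gamma Lf mc).
have mh : measurable_fun [set: past t * present t] h.
  apply: mstep; first exact: (measurableT_comp (@adapted_cgd t) measurable_fst).
  move=> i; apply: (measurableT_comp _ measurable_snd).
  exact: (@measurable_cyl _ _ _ _ _ xip _ (i, t)).
have h0 z : (0 <= h z)%E by rewrite lee_fin gap_ge0.
have -> : gap t.+1 = (\int[P]_w \int[P]_w' h (w, w'))%E.
  rewrite /gap; under eq_integral do rewrite XS.
  have mU : measurable_fun setT (id : O -> past t) by exact: (cyl_measurable Ixi).
  have mV : measurable_fun setT (id : O -> present t) by exact: (cyl_measurable Ixi).
  have UV : indep_elts P (id : O -> past t) (id : O -> present t).
    apply: (indep_cyl Ixi); apply/seteqP; split => // p /= [].
    by move=> /[swap] ->; rewrite ltnn.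
  exact: (ge0_integral_indep mU mV UV mh h0).
have mX := measurable_cgd t.
(* After freezing, both integrals run over [O], so measurability of the inner one requires [h] on
   [O * O]. *)
have mhO : measurable_fun [set: O * O] h.
  apply: mstep; first exact: (measurableT_comp mX measurable_fst).
  by move=> i; apply: (measurableT_comp (Ixi.1 (i, t)) measurable_snd).
have minner : measurable_fun setT (fun w : O => \int[P]_w' h (w, w'))%E.
  exact: (@measurable_fun_fubini_tonelli_F _ _ O O R P h mhO h0).
have msq : measurable_fun setT
    (fun w : O => (gamma / 2 * sqnorm (grad ft (X t w)))%:E).
  apply/measurable_EFinP; apply: measurable_funM; first exact: measurable_cst.
  exact: (measurableT_comp (measurable_sqnorm_grad_ftilde xs alpha Lf) mX).
have sq0 x : (0 <= (gamma / 2 * sqnorm (grad ft x))%:E)%E.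
  by rewrite lee_fin mulr_ge0 ?sqnorm_ge0// divr_ge0// ltW.
have inner0 (w : O) : (0 <= \int[P]_w' h (w, w'))%E by exact: integral_ge0.
have mgapX : measurable_fun setT (fun w : O => (ft (X t w) - favg)%:E).
  by apply/measurable_EFinP; exact: (measurableT_comp mgap mX).
rewrite /sqgrad -ge0_integralD//.
rewrite /gap -ge0_integralZl//=; last 2 first.
- by move=> w _; rewrite lee_fin gap_ge0.
- by rewrite lee_fin addr_ge0.
apply: ge0_le_integral => //.
- by move=> w _; apply: adde_ge0.
- exact: emeasurable_funD.
- exact: measurable_funeM.
(* The one-step bound at the fixed point [X t w]. *)
- by move=> w _; rewrite -EFinM; exact: expected_descent.
Qed.

Lemma expected_descent_sum k :
  (gap k + \sum_(t < k) sqgrad t <= ((1 + a) ^+ k * (ft x0 - favg))%:E)%E.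
Proof.
have gap0 t : (0 <= gap t)%E.
  by apply: integral_ge0 => w _; rewrite lee_fin gap_ge0.
have sq0 t : (0 <= sqgrad t)%E.
  apply: integral_ge0 => w _.
  by rewrite lee_fin mulr_ge0 ?sqnorm_ge0// divr_ge0// ltW.
elim: k => [|k IH].
  rewrite big_ord0 adde0 expr0 mul1r /gap.
  by under eq_integral do rewrite X0; rewrite integral_prob_cst.
have sum0 : (0 <= \sum_(t < k) sqgrad t)%E by apply: sume_ge0.
rewrite big_ord_recr/= addeA addeAC.
apply: le_trans (leeD2r _ (expected_descent_cgd k)) _.
apply: (@le_trans _ _ ((1 + a)%:E * (gap k + \sum_(t < k) sqgrad t))%E).
  (* Since [1 + a >= 1], the earlier gradient terms may be multiplied too, and the induction
     hypothesis applies to the whole block. *)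
  have absorb (D Q : \bar R) : (0 <= D -> 0 <= Q ->
      (1 + a)%:E * D + Q <= (1 + a)%:E * (D + Q))%E.
    by move=> D0 Q0; rewrite ge0_muleDr// leeD// lee_pemull// lee_fin lerDl.
  exact: absorb.
rewrite exprS -mulrA EFinM; apply: lee_wpmul2l => //.
by rewrite lee_fin addr_ge0.
Qed.

(** Each of the [k] terms of the telescoped sum is at least [gamma / 2] times the minimum, and the
    final gap is nonnegative. *)
Lemma min_expected_sqnorm_grad_le k : (0 < k)%N ->
  (\big[Order.min/+oo]_(t < k)
      \int[P]_w (sqnorm (grad ft (X t w)))%:E
   <= (2 * (1 + a) ^+ k / (gamma * k%:R) * (ft x0 - favg))%:E)%E.
Proof.
move=> k0; set m := \big[_/_]_(t < k) _.
have g2 : 0 <= gamma / 2 by rewrite divr_ge0// ltW.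
have r0 t : (0 <= \int[P]_w (sqnorm (grad ft (X t w)))%:E)%E.
  by apply: integral_ge0 => w _; rewrite lee_fin sqnorm_ge0.
have sqE t : (sqgrad t = (gamma / 2)%:E * \int[P]_w (sqnorm (grad ft (X t w)))%:E)%E.
  rewrite /sqgrad -ge0_integralZl//.
  - apply/measurable_EFinP.
    exact: (measurableT_comp (measurable_sqnorm_grad_ftilde xs alpha Lf) (measurable_cgd t)).
  - by move=> w _; rewrite lee_fin sqnorm_ge0.
have sq0 t : (0 <= sqgrad t)%E by rewrite sqE mule_ge0.
have mle (t : 'I_k) : ((gamma / 2)%:E * m <= sqgrad t)%E.
  by rewrite sqE lee_wpmul2l//; exact: bigmin_le.
have tot : (\sum_(t < k) (gamma / 2)%:E * m <= ((1 + a) ^+ k * (ft x0 - favg))%:E)%E.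
  apply: le_trans (expected_descent_sum k).
  apply: (@le_trans _ _ (\sum_(t < k) sqgrad t)%E); first exact: lee_sum.
  rewrite leeDr//; apply: integral_ge0 => w _.
  by rewrite lee_fin gap_ge0.
have m0 : (0 <= m)%E by apply: le_bigmin => //; exact: leey.
clearbody m; clear mle sqE r0 sq0.
(* A finite minimum is isolated by division; an infinite one would make the sum infinite, as
   [k > 0], against its real bound. *)
case: m m0 tot => [r _|_|//].
  have -> : (\sum_(t < k) (gamma / 2)%:E * r%:E = (k%:R * (gamma / 2 * r))%:E)%E.
    by rewrite -EFinM sumEFin sumr_const card_ord mulr_natl.
  have gk : 0 < k%:R * (gamma / 2) by rewrite mulr_gt0 ?ltr0n// divr_gt0.
  rewrite !lee_fin mulrA mulrC -ler_pdivlMr// => /le_trans; apply.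
  rewrite le_eqVlt; apply/orP; left; apply/eqP; field.
  by rewrite pnatr_eq0 -lt0n k0 gt_eqF.
case: k k0 => // k _.
rewrite mulry gtr0_sg ?divr_gt0// mul1e big_ord_recl addye ?leye_eq// -ltNye.
by apply: (lt_le_trans ltNy0); exact: sume_ge0.
Qed.

End compressed_gradient_descent.

Unset Implicit Arguments.

Theorem theorem7 (R : realType) (d n : nat)
  (f : 'I_n -> 'rV[R]_d -> R) (L fstar : 'I_n -> R) (xs : 'I_n -> 'rV[R]_d)
  (alpha om : 'I_n -> R)
  (dO : measure_display) (O : measurableType dO) (P : probability O R)
  (dS : measure_display) (S : measurableType dS)
  (xi : 'I_n -> nat -> O -> S) (c : 'I_n -> nat -> S -> 'rV[R]_d -> 'rV[R]_d)
  (gamma : R) (x0 : 'rV[R]_d) (X : nat -> O -> 'rV[R]_d) :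
  (0 < n)%N ->
  (forall i, 0 <= L i /\ Lsmooth (f i) (L i)) ->
  (forall i, (exists z, f i z = fstar i) /\ (forall y, fstar i <= f i y)) ->
  (forall i, grad (f i) (xs i) = 0) ->
  (forall i, 0 < alpha i < 1) ->
  (forall i, 0 <= om i) ->
  mutually_independent P (fun p : 'I_n * nat => xi p.1 p.2) ->
  (forall i t, measurable_fun setT
     (fun p : (S * @vecM R d)%type => (c i t p.1 p.2 : @vecM R d))) ->
  (forall i t, in_B P (fun w => c i t (xi i t w)) (om i)) ->
  let Lalpha := n%:R^-1 * \sum_(i < n) alpha i ^+ 2 * L i in
  let fstar_avg := n%:R^-1 * \sum_(i < n) fstar i in
  let M := \big[Num.max/0]_(i < n) (L i * om i * alpha i ^+ 2) in
  0 < gamma -> gamma * Lalpha <= 1 ->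
  (forall w, X 0%N w = x0) ->
  (forall t w, X t.+1 w = X t w - gamma *: (n%:R^-1 *:
      \sum_(i < n) c i t (xi i t w) (alpha i *: grad (f i) (Tmap (alpha i) (xs i) (X t w))))) ->
  forall k : nat, (0 < k)%N ->
    (\big[Order.min/+oo]_(t < k)
        \int[P]_w (sqnorm (grad (ftilde f alpha xs) (X t w)))%:E
     <= (2 * (1 + 2 * Lalpha * gamma ^+ 2 * M / n%:R) ^+ k / (gamma * k%:R)
           * (ftilde f alpha xs x0 - fstar_avg))%:E)%E.
Proof.
move=> _ Lf fmin gxs _ om0 Ixi mc Bc Lalpha favg M g0 gL X0 XS k k0.
exact: (min_expected_sqnorm_grad_le Lf (fun i => (fmin i).2) gxs om0 g0 gL
  Ixi mc Bc X0 XS k0).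
Qed.
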